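(* Let $k\geq 3$ be an integer. Then $$f(k)=\left\lfloor\frac{k^2}{4}\right\rfloor+1.$$
   Context: For a positive integer $m$, write $[m]=\{1,\ldots,m\}$. An ordered clique (ordered complete graph) is a complete graph together with a total ordering $<$ of its vertex set. Dependency digraph and admissibility. Let $\chi$ be a red-blue edge-coloring of the ordered clique with vertices $v_1<v_2<\cdots<v_N$. The dependency digraph $D(\chi)$ has vertex set $\{v_1,\ldots,v_N\}$ and the following directed edges: for every $i\in[N-1]$ and $j\in[N]\setminus\{i,i+1\}$, if $\chi(v_iv_{i+1})$ is red and both $\chi(v_iv_j)$ and $\chi(v_{i+1}v_j)$ are blue, then $D(\chi)$ contains the directed edges $(v_j,v_i)$ and $(v_j,v_{i+1})$; there are no other directed edges. Arcs in both directions between two vertices may occur, and such a pair of opposite arcs counts as a directed cycle of length two. The coloring $\chi$ is admissible if $D(\chi)$ is acyclic (has no directed cycle). Induced colorings. For a subset $X$ of the vertices, the coloring induced on $X$ is the restriction of $\chi$ to the edges within $X$, viewed as a coloring of the ordered clique on $X$ with the induced order; in particular, consecutive vertices in the definition of the dependency digraph of the induced coloring are vertices consecutive in the order induced on $X$. The function $f$. For an integer $k\geq 1$, $f(k)$ is the minimum integer $N$ such that for every red-blue edge-coloring of the ordered clique on $N$ vertices there exist $k$ vertices such that the coloring induced on these $k$ vertices is admissible. *)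

(* Defs.v *)
From HB Require Import structures.
From mathcomp Require Import all_boot all_order.

Set Implicit Arguments.
Unset Strict Implicit.
Unset Printing Implicit Defensive.

Import Order.Theory.

Definition color := bool.
Definition red : color := true.
Definition blue : color := false.

(* The edge xy is the set [set x; y].  Only the values of a coloring at
   two-element sets are ever used. *)
Definition coloring (T : finType) := {set T} -> color.

Section DependencyDigraph.
Local Open Scope order_scope.
Variables (d : Order.disp_t) (T : finOrderType d).

Definition consecutive (x y : T) : bool :=
  (x < y) && ~~ [exists z : T, x < z < y].

Definition dependency (chi : coloring T) : rel T :=
  fun u w => [exists x : T, exists y : T,
    [&& consecutive x y, u \notin [set x; y],
        chi [set x; y] == red,
        chi [set x; u] == blue, chi [set y; u] == blue
      & w \in [set x; y]]].

(* [ucycle e c]: c is a duplicate-free cyclic sequence of vertices with an arc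
   from each vertex to the next (and from the last to the first).  Since
   [dependency chi] is irreflexive, such a nonempty c has length at least two;
   length two is a pair of opposite arcs. *)
Definition admissible (chi : coloring T) : Prop :=
  ~ exists c : seq T, c != [::] /\ ucycle (dependency chi) c.

End DependencyDigraph.

Section Induced.
Variables (d : Order.disp_t) (T : finOrderType d) (X : {set T}).

Definition vertices_of : Type := {x : T | x \in X}.

HB.instance Definition _ := SubFinite.on vertices_of.
HB.instance Definition _ := [SubChoice_isSubOrder of vertices_of by <: with d].

Definition induced (chi : coloring T) : coloring vertices_of :=
  fun e => chi (val @: e).

End Induced.

Arguments induced {d T} X chi.

Definition forces (k N : nat) : Prop :=
  forall chi : coloring 'I_N,
    exists X : {set 'I_N}, #|X| = k /\ admissible (induced X chi).

(* f(k) = m, with f(k) the minimum N such that [forces k N]; a relation, so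
   that the existence of the minimum is part of the assertion. *)
Definition is_f (k m : nat) : Prop :=
  forces k m /\ forall N : nat, forces k N -> m <= N.

(* Main.v *)
Require Import Defs.
From mathcomp Require Import all_boot all_order.
From mathcomp Require Import zify.

(**
Lower bound: cut at most a * b vertices, with a = uphalf k and b = k./2, into
a intervals of at most b vertices, red inside and blue across.  Among any
k = a + b vertices two intervals contain two chosen vertices each, and two such
intervals send arcs to each other.

Upper bound: let h v be the number of vertices of a longest increasing blue path
ending at v, and m its maximum.  If m >= k, k consecutive vertices of a blue
path do.  The classes of h are red cliques, so some class A has
m * #|A| >= N > k ^ 2 / 4, whence m + #|A| > k.  Let y be the least vertex of A.
Join to A an increasing blue path L of maximal length ending just before y, and
the part U above the level of A of a longest increasing blue path; since U
starts after an element of A, we get L < y < U and m + #|A| - 1 >= k vertices.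
All red consecutive pairs lie in A and U and meet A.  Hence A has no outgoing
arc, L no incoming one, and an arc inside U goes down: a vertex of U that is
blue to an element of A comes after it.
*)

Set Implicit Arguments.
Unset Strict Implicit.
Unset Printing Implicit Defensive.

Import Order.Theory.

(** * Induced digraphs and an acyclicity criterion *)

Section Admissibility.
Local Open Scope order_scope.
Variables (d : Order.disp_t) (T : finOrderType d) (chi : coloring T).
Implicit Types (X A U : {set T}) (u v w x y z : T).

Definition consecutive_in X x y :=
  [&& x \in X, y \in X, x < y & ~~ [exists z in X, x < z < y]].

Lemma dependency_inducedP X (u w : vertices_of X) :
  reflect (exists x y, [/\ consecutive_in X x y, val u \notin [set x; y],
             chi [set x; y] = red,
             chi [set x; val u] = blue /\ chi [set y; val u] = blue
           & val w \in [set x; y]])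
          (dependency (induced X chi) u w).
Proof.
have chiE (a b : vertices_of X) :
    induced X chi [set a; b] = chi [set val a; val b].
  by rewrite /induced imsetU1 imset_set1.
have inE2 (c a b : vertices_of X) :
    (c \in [set a; b]) = (val c \in [set val a; val b]).
  by rewrite !inE -!val_eqE.
have consE (a b : vertices_of X) :
    consecutive a b = consecutive_in X (val a) (val b).
  rewrite /consecutive /consecutive_in (valP a) (valP b) /=.
  congr (_ && ~~ _); apply/idP/idP => /existsP[z].
    by move=> hz; apply/existsP; exists (val z); rewrite (valP z).
  by case/andP=> zX hz; apply/existsP; exists (exist _ z zX).
apply: (iffP existsP) => [[x /existsP[y /and5P[]]]|[x [y []]]].
  rewrite consE !inE2 !chiE => h1 h2 /eqP h3 /eqP h4 /andP[/eqP h5 h6].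
  by exists (val x), (val y).
move=> hc h2 h3 [h4 h5] h6; case/and4P: (hc) => xX yX _ _.
exists (exist _ x xX); apply/existsP; exists (exist _ y yX).
by rewrite consE !inE2 !chiE /= hc h2 h3 h4 h5 h6.
Qed.

(* Every arc starts outside the red clique [A] and ends in [A :|: U], so cycles
   stay inside [U], where arcs decrease the vertex. *)
Lemma admissible_of_clique_and_tail X A U :
    {in A &, forall x y, x != y -> chi [set x; y] = red} ->
    {in A & U, forall y u, chi [set y; u] = blue -> y < u} ->
    (forall x y, consecutive_in X x y -> chi [set x; y] = red ->
       [/\ x \in A :|: U, y \in A :|: U & (x \in A) || (y \in A)]) ->
  admissible (induced X chi).
Proof.
move=> Ared Ublue Xcons [c [c0 /andP[cyc _]]].
have tailP (u w : vertices_of X) :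
    dependency (induced X chi) u w -> val u \notin A /\ val w \in A :|: U.
  case/dependency_inducedP=> x [y [hc hu hr [hbx hby] hw]].
  have [hx hy hA] := Xcons _ _ hc hr; split.
    apply/negP=> uA; move: hu; rewrite !inE negb_or => /andP[ux uy].
    case/orP: hA => hA; [move: hbx|move: hby].
      by rewrite Ared // eq_sym.
    by rewrite Ared // eq_sym.
  by case/set2P: hw => ->.
have cU (w : vertices_of X) : w \in c -> val w \in U.
  move=> wc; have [hA _] := tailP _ _ (next_cycle cyc wc).
  have [_] := tailP _ _ (prev_cycle cyc wc).
  by rewrite inE (negbTE hA).
have decr (u w : vertices_of X) : u \in c -> w \in c ->
    dependency (induced X chi) u w -> val w < val u.
  move=> /cU uU /cU wU /dependency_inducedP[x [y [hc hu hr [hbx hby] hw]]].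
  have [hx hy hA] := Xcons _ _ hc hr.
  case/and4P: hc => xX yX xy /existsPn nobetween.
  have := nobetween (val u); rewrite (valP u) /= negb_and -!leNgt => hle.
  move: hu hw; rewrite !inE negb_or => /andP[ux uy].
  (* The end of the pair that lies in [A] precedes [u]; since [u] is not between the two ends, both
     precede it. *)
  case/orP: hA => hA.
    have xu := Ublue _ _ hA uU hbx.
    have yu : y < val u.
      by rewrite lt_neqAle eq_sym uy; case/orP: hle => //; rewrite leNgt xu.
    by case/orP=> /eqP ->.
  have yu := Ublue _ _ hA uU hby.
  by case/orP=> /eqP -> //; apply: lt_trans yu.
case: c c0 cyc cU decr => // v c _ cyc _ decr.
pose m := [arg min_(w < v in v :: c) val w].
have [mc mmin] : m \in v :: c /\
    forall w : vertices_of X, w \in v :: c -> (val m <= val w)%O.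
  by rewrite /m; case: arg_minP; rewrite ?mem_head.
have nc : next (v :: c) m \in v :: c by rewrite mem_next.
have := decr _ _ mc nc (next_cycle cyc mc).
by rewrite ltNge mmin.
Qed.

(** * Increasing blue paths and heights *)

Definition blue_lt u v := (u < v) && (chi [set u; v] == blue).

Lemma path_blue_lt x s : path blue_lt x s -> path <%O x s.
Proof. by apply: sub_path => u v /andP[]. Qed.

Lemma uniq_blue_path a s : path blue_lt a s -> uniq (a :: s).
Proof. by move/path_blue_lt => ps; apply: lt_sorted_uniq. Qed.

(** The path increases, so two of its vertices with no other one between them are neighbours on
    it. *)
Lemma blue_path_consecutive a s x y : path blue_lt a s ->
    x \in a :: s -> y \in a :: s -> x < y ->
    (forall z, z \in a :: s -> ~~ (x < z < y)) ->
  chi [set x; y] = blue.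
Proof.
elim: s a => [|b s IHs] a /=.
  by move=> _; rewrite !inE => /eqP -> /eqP ->; rewrite ltxx.
case/andP=> /andP[ab /eqP chiab] pbs.
have gea z : z \in b :: s -> a < z.
  have /= := path_blue_lt pbs; rewrite lt_path_sortedE => /andP[/allP hb _].
  rewrite inE => /orP[/eqP -> //|/hb]; exact: lt_trans.
rewrite inE => /orP[/eqP ->|xs].
  rewrite inE => /orP[/eqP ->|ys ay nobetween]; first by rewrite ltxx.
  have := nobetween b; rewrite !inE eqxx orbT ab /= => /(_ isT) nby.
  move: ys; rewrite inE => /orP[/eqP -> //|ys].
  have := path_blue_lt pbs; rewrite lt_path_sortedE => /andP[/allP/(_ _ ys)].
  by move=> hby; rewrite hby in nby.
rewrite inE => /orP[/eqP ->|ys xy nobetween].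
  by move/lt_trans/(_ (gea _ xs)); rewrite ltxx.
by apply: (IHs b) => // z zs; apply: nobetween; rewrite inE zs orbT.
Qed.

(** Recursion along [<], bounded by fuel: the value is independent of [n] once [n] is at least the
    number of vertices below [v]. *)
Fixpoint height_rec n v : nat :=
  if n is n'.+1 then \max_(u | blue_lt u v) (height_rec n' u).+1 else 0.

(* One less than the number of vertices of a longest increasing blue path
   ending at [v]. *)
Definition height v := height_rec #|T| v.

Lemma heightE v : height v = \max_(u | blue_lt u v) (height u).+1.
Proof.
pose rk w := #|[set x | x < w]|.
have rk_lt u w : u < w -> (rk u < rk w)%N.
  move=> uw; apply: proper_card; apply/properP; split.
    by apply/subsetP=> x; rewrite !inE => /lt_trans; apply.
  by exists u; rewrite !inE ?ltxx.
have stable n n' w : (rk w <= n)%N -> (rk w <= n')%N ->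
    height_rec n w = height_rec n' w.
  elim: n n' w => [|n IHn] [|n'] w //= hn hn'.
  - by rewrite big_pred0 // => u; apply/negP=> /andP[/rk_lt]; lia.
  - by rewrite big_pred0 // => u; apply/negP=> /andP[/rk_lt]; lia.
  by apply: eq_bigr => u /andP[/rk_lt uw _]; rewrite (IHn n') //; lia.
rewrite {1}/height (stable _ #|T|.+1) //=; first exact: max_card.
by apply: leq_trans (max_card _) _.
Qed.

Lemma height_lt u v : blue_lt u v -> (height u < height v)%N.
Proof. by move=> uv; rewrite (heightE v); apply: (leq_bigmax_cond u). Qed.

(** Stepping down to a predecessor that attains the maximum in [heightE] lowers the height by
    exactly one, so no level is skipped. *)
Lemma blue_path_from_height l v : (l <= height v)%N ->
  exists w s, [/\ height w = l, path blue_lt w s, last w s = v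
                & size s = height v - l]%N.
Proof.
move En: (height v - l)%N => n; elim: n v En => [|n IHn] v En lv.
  by exists v, [::]; split=> //; lia.
have [u uv Eu] : exists2 u, blue_lt u v & height v = (height u).+1.
  rewrite (heightE v).
  have [u0 hu0|none] := pickP (fun u => blue_lt u v).
    have c0 : (0 < #|(fun u => blue_lt u v)|)%N by apply/card_gt0P; exists u0.
    by have [u hu ->] := eq_bigmax_cond (fun u => (height u).+1) c0; exists u.
  by move: En; rewrite heightE big_pred0.
have [||w [s [hw ps ls ss]]] := IHn u; [lia|lia|].
exists w, (rcons s v); split=> //; last by rewrite size_rcons ss.
  by rewrite rcons_path ps ls.
by rewrite last_rcons.
Qed.

Lemma mem_path_le_last a s x :
  path blue_lt a s -> x \in a :: s -> x <= last a s.
Proof.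
elim: s a x => [|b s IHs] a x /=; first by rewrite inE => _ /eqP ->.
case/andP=> /andP[ab _] pbs; rewrite inE => /orP[/eqP ->|]; last exact: IHs.
by apply: le_trans (ltW ab) _; apply: IHs; rewrite ?mem_head.
Qed.

(** All consecutive pairs are blue, so the digraph has no arcs. *)
Lemma blue_path_admissible a s : path blue_lt a s ->
  admissible (induced [set z in a :: s] chi).
Proof.
move=> ps; apply: (@admissible_of_clique_and_tail _ set0 set0).
- by move=> x y; rewrite inE.
- by move=> x y; rewrite inE.
move=> x y; rewrite /consecutive_in !in_set => /and4P[xs ys xy /existsPn hz].
rewrite (blue_path_consecutive ps xs ys xy) // => z zs.
by have := hz z; rewrite in_set zs.
Qed.

(** Averaging: heights take at most [(\max_v height v).+1] values. *)
Lemma large_height_class :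
  exists l, (#|T| <= (\max_v height v).+1 * #|[set v | height v == l]|)%N.
Proof.
set m := \max_v height v.
pose c (l : 'I_m.+1) := #|[set v | height v == l]|.
have [l lmax] : exists l, forall j, (c j <= c l)%N.
  have [|l cl] := @bigop.eq_bigmax _ c; first by rewrite card_ord.
  by exists l => j; rewrite -cl leq_bigmax.
exists (val l); rewrite -/(c l) -sum1_card.
rewrite (partition_big (fun v => inord (height v) : 'I_m.+1) predT) //=.
rewrite -[m.+1 in leqRHS]card_ord -sum_nat_const; apply: leq_sum => j _.
apply: leq_trans (lmax j); rewrite sum1_card /c; apply: subset_leq_card.
apply/subsetP=> v; rewrite !inE unfold_in /= => /eqP <-.
by rewrite inordK // ltnS /m (leq_bigmax v).
Qed.

(** * Upper bound *)

Lemma exists_admissible k : (0 < k)%N -> (k ^ 2 %/ 4 < #|T|)%N ->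
  exists X, #|X| = k /\ admissible (induced X chi).
Proof.
move=> k0 kT; have T0 := leq_ltn_trans (leq0n _) kT.
have [vt hvt] := @bigop.eq_bigmax _ height T0.
have [l] := large_height_class; rewrite hvt => Tl.
(* [(height vt).+1] is the number m of the overview. If it is at least [k], the last [k] vertices of
   a longest path are taken. *)
have [khi|klo] := leqP k (height vt).+1.
  have [|w [s [_ ps _ ss]]] := @blue_path_from_height ((height vt).+1 - k) vt.
    lia.
  exists [set z in w :: s]; split; last exact: blue_path_admissible.
  have /card_uniqP us := uniq_blue_path ps.
  by rewrite cardsE us /= ss; lia.
set A := [set v | height v == l] in Tl.
(* Otherwise AM-GM bounds the product in [Tl] by [k ^ 2 / 4]. *)
have cardA : (k < (height vt).+1 + #|A|)%N.
  rewrite ltnNge; apply/negP=> hle; move: kT; rewrite ltnNge => /negP; apply.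
  apply: leq_trans Tl _; rewrite leq_divRL //.
  by rewrite mulnC (leq_trans (nat_AGM2 _ _).1) ?leq_sqr.
have [y0 y0A] : exists y, y \in A by apply/set0Pn; rewrite -card_gt0; lia.
have [y1 [y1A y1min]] : exists y, y \in A /\ forall z, z \in A -> y <= z.
  case: (@arg_minP _ _ _ y0 (fun y => y \in A) id y0A) => y yA ymin.
  by exists y.
have hA z : z \in A -> height z = l by rewrite inE => /eqP.
have llt : (l <= height vt)%N by rewrite -(hA _ y1A) -hvt leq_bigmax.
(* Only as much of [A] is kept as brings the total to exactly [k]. *)
have [t [ut st tA]] : exists t, [/\ uniq t, size t = (k - (height vt).+1)%N
    & {subset t <= A :\ y1}].
  by apply/card_geqP; rewrite (cardsD1 y1) y1A in cardA; lia.
(* [w0 :: s0] is L followed by [y1], with [l + 1] vertices. [s1] is U: the path starts at [w1] in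
   [A], which is left out. *)
have [|w0 [s0 [_ ps0 ls0 ss0]]] := @blue_path_from_height 0 y1; first by [].
have [w1 [s1 [hw1 ps1 _ ss1]]] := blue_path_from_height llt.
have w1A : w1 \in A by rewrite inE hw1.
have s1gt z : z \in s1 -> w1 < z.
  by move=> zs; have /lt_path_min/allP/(_ _ zs) := path_blue_lt ps1.
have s1h z : z \in s1 -> (l < height z)%N.
  have : path (relpre height ltn) w1 s1.
    by apply: sub_path ps1 => u v; apply: height_lt.
  move/order_path_min => /(_ (fun _ _ _ => @ltn_trans _ _ _))/allP hall zs.
  by have := hall _ zs; rewrite /= hw1.
have s0le z : z \in w0 :: s0 -> z <= y1.
  by rewrite -ls0; apply: mem_path_le_last.
have s1y z : z \in s1 -> y1 < z.
  by move=> /s1gt; apply: le_lt_trans; apply: y1min.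
have ty z : z \in t -> y1 < z.
  by move=> /tA; rewrite in_setD1 lt_neqAle eq_sym => /andP[-> /y1min].
have y1s0 : y1 \in w0 :: s0 by rewrite -ls0 mem_last.
pose s := (w0 :: s0) ++ s1 ++ t.
have us : uniq s.
  rewrite cat_uniq (uniq_blue_path ps0) /= cat_uniq ut.
  have := uniq_blue_path ps1; rewrite cons_uniq => /andP[_ ->]; rewrite andbT.
  apply/andP; split; apply/hasPn => z; last first.
    move=> /tA; rewrite in_setD1 => /andP[_ /hA hz].
    by apply/negP=> /s1h; rewrite hz ltnn.
  rewrite mem_cat => zst; apply/negP => /s0le.
  by rewrite leNgt; case/orP: zst => [/s1y|/ty] ->.
have inA z : (z \in [set z in y1 :: t]) = (z \in y1 :: t) by rewrite in_set.
exists [set z in s]; split.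
  move/card_uniqP: us; rewrite cardsE => ->.
  by rewrite !size_cat /= ss0 ss1 st (hA _ y1A); lia.
have y1tA z : z \in y1 :: t -> z \in A.
  by rewrite inE => /orP[/eqP -> //|/tA]; rewrite in_setD1 => /andP[].
apply: (@admissible_of_clique_and_tail _ [set z in y1 :: t] [set z in s1]).
- have nblue x y : x \in A -> y \in A -> x < y -> chi [set x; y] = red.
    move=> /hA hx /hA hy xy; case: (boolP (chi [set x; y])) => // /negbTE b.
    suff : (height x < height y)%N by rewrite hx hy ltnn.
    by apply: height_lt; rewrite /blue_lt xy b.
  move=> x y; rewrite !inA => /y1tA xA /y1tA yA.
  by case: ltgtP => // [xy|yx] _; [|rewrite setUC]; apply: nblue.
(* A blue edge from [u] up to [y] would make [u] lower in height than [y], but [u] is above the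
   level of [A]. *)
- move=> y u; rewrite inA in_set => /y1tA yA us1 b.
  rewrite ltNge le_eqVlt; apply/negP=> /orP[/eqP uy|uy].
    by have := s1h _ us1; rewrite uy (hA _ yA) ltnn.
  suff : (height u < height y)%N by rewrite (hA _ yA) ltnNge (ltnW (s1h _ us1)).
  by apply: height_lt; rewrite /blue_lt uy setUC b.
move=> x y; rewrite /consecutive_in !in_set.
case/and4P=> xs ys xy /existsPn between red_xy.
have {}between z : z \in s -> ~~ (x < z < y).
  by move=> zs; have := between z; rewrite in_set zs.
(* No red consecutive pair lies on such a path. The alternative [z <= x] covers [w1], which need not
   belong to [s]. *)
have blueP a r : path blue_lt a r ->
    (forall z, z \in a :: r -> z \in s \/ z <= x) ->
    x \in a :: r -> y \in a :: r -> False.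
  move=> pr rs xr yr; move: red_xy.
  rewrite (blue_path_consecutive pr xr yr xy) //.
  by move=> z /rs[/between //|zx]; rewrite [x < z]ltNge zx.
have y1x : y1 <= x.
  have in_s0 z : z \in s -> z <= y1 -> z \in w0 :: s0.
    by rewrite !mem_cat => /or3P[//|/s1y|/ty]; rewrite ltNge => /negP.
  rewrite leNgt; apply/negP=> xy1; apply: (blueP _ _ ps0).
  - by move=> z zs; left; rewrite mem_cat zs.
  - exact: in_s0 (ltW xy1).
  apply: in_s0 => //; rewrite leNgt; apply/negP=> y1y.
  by have := between y1; rewrite xy1 y1y mem_cat y1s0 => /(_ isT).
have upper z : z \in s -> y1 <= z -> (z \in y1 :: t) || (z \in s1).
  rewrite !mem_cat => /or3P[/s0le zy1 y1z|->|zt]; rewrite ?orbT //.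
    by rewrite inE eq_le zy1 y1z.
  by rewrite inE zt orbT.
have xu := upper _ xs y1x; have yu := upper _ ys (ltW (le_lt_trans y1x xy)).
split=> //; case/orP: xu => [-> //|xs1]; case/orP: yu => [->|ys1].
  by rewrite orbT.
exfalso; apply: (blueP _ _ ps1); rewrite ?inE ?xs1 ?ys1 ?orbT // => z.
rewrite inE => /orP[/eqP ->|zs1]; first by right; apply: ltW; apply: s1gt.
by left; rewrite !mem_cat zs1 orbT.
Qed.

Lemma exists_consecutive X x y : x \in X -> y \in X -> x < y ->
  exists2 z, consecutive_in X x z & z <= y.
Proof.
move=> xX yX xy; pose P z := (z \in X) && (x < z).
have Py : P y by rewrite /P yX.
case: (@arg_minP _ _ _ y P id Py) => z /andP[zX xz] zmin.
exists z; last exact: zmin.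
rewrite /consecutive_in xX zX xz /=; apply/existsPn => w.
apply/and3P=> -[wX xw]; rewrite ltNge => /negP; apply.
by apply: zmin; rewrite /P wX.
Qed.

End Admissibility.

Lemma forces_of_large k N : 0 < k -> k ^ 2 %/ 4 < N -> forces k N.
Proof.
by move=> k0 kN chi; apply: exists_admissible => //; rewrite card_ord.
Qed.

(** * Lower bound: red blocks joined by blue edges *)

Definition block_coloring N b : coloring 'I_N :=
  fun e => [forall x in e, forall y in e, x %/ b == y %/ b].

Lemma block_coloringE N b (x y : 'I_N) :
  block_coloring b [set x; y] = (x %/ b == y %/ b).
Proof.
apply/forall_inP/eqP => [h|xy u /set2P[] ->].
- exact/eqP/(forall_inP (h x (set21 x y)))/set22.
- by apply/forall_inP=> v /set2P[] ->; rewrite ?xy.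
by apply/forall_inP=> v /set2P[] ->; rewrite ?xy.
Qed.

Lemma pigeonhole_set (aT rT : finType) (f : aT -> rT) (D : {set aT}) :
  #|f @: D| < #|D| -> exists x y, [/\ x \in D, y \in D, x != y & f x = f y].
Proof.
move=> lt_fD; have : ~~ dinjectiveb f D.
  by apply: contraL lt_fD => /dinjectiveP/card_in_imset ->; rewrite ltnn.
case/dinjectivePn=> x xD [y]; rewrite inE => /andP[yx yD] fxy.
by exists x, y; rewrite eq_sym.
Qed.

(** The successor of the smaller vertex in [X] is at most the larger one, hence in the same block by
    monotonicity of division. *)
Lemma block_consecutive N b (X : {set 'I_N}) (x y : 'I_N) :
    x \in X -> y \in X -> x != y -> x %/ b = y %/ b ->
  exists u v, consecutive_in X u v /\ u %/ b = x %/ b /\ v %/ b = x %/ b.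
Proof.
move=> xX yX nxy; wlog xy : x y xX yX nxy / (x < y)%O => [hw|exy].
  have := nxy; rewrite neq_lt => /orP[xy exy|yx exy]; first exact: (hw x y).
  have nyx : y != x by rewrite eq_sym.
  by have [u [v]] := hw _ _ yX xX nyx yx (esym exy); exists u, v; rewrite exy.
have [v cv vy] := exists_consecutive xX yX xy; exists x, v; do 2 split=> //.
case/and4P: cv => _ _ xv _; move: xv vy; rewrite ltEord leEord => xv vy.
by apply/eqP; rewrite eqn_leq {1}exy !leq_div2r // ltnW.
Qed.

(** Two applications of the pigeonhole principle: some block contains two chosen vertices, and after
    removing that block another one still does. *)
Lemma not_forces_blocks a b N : 0 < b -> N <= a * b -> ~ forces (a + b) N.
Proof.
move=> b0 Nab /(_ (@block_coloring N b))[X [cardX]]; apply.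
have fa (x : 'I_N) : x %/ b < a.
  by rewrite ltn_divLR //; apply: leq_trans Nab.
pose f x := Ordinal (fa x).
have [|x0 [y0 [x0X y0X xy0 fxy0]]] := @pigeonhole_set _ _ f X.
  apply: leq_ltn_trans (max_card _) _; rewrite card_ord cardX; lia.
pose Y := [set x in X | f x == f x0].
(* Residues modulo [b] separate the vertices of a block. *)
have cardY : #|Y| <= b.
  rewrite leqNgt; apply/negP => bY.
  pose r (x : 'I_N) := Ordinal (ltn_pmod x b0).
  have [|x [y [xY yY xy]]] := @pigeonhole_set _ _ r Y.
    by apply: leq_ltn_trans (max_card _) _; rewrite card_ord.
  move/(congr1 val) => /= mxy; move: xY yY xy; rewrite !inE.
  move=> /andP[_ /eqP/(congr1 val) /= hx] /andP[_ /eqP/(congr1 val) /= hy].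
  by rewrite -val_eqE /= (divn_eq x b) (divn_eq y b) hx hy mxy eqxx.
(* At least [a] chosen vertices remain, in at most [a - 1] blocks. *)
have [|x1 [y1 [x1X y1X xy1 fxy1]]] := @pigeonhole_set _ _ f (X :\: Y).
  have YX : Y \subset X by apply/subsetP=> z; rewrite inE => /andP[].
  have : #|X :\: Y| = #|X| - #|Y| by rewrite cardsD (setIidPr YX).
  have : f @: (X :\: Y) \subset [set~ f x0].
    apply/subsetP=> _ /imsetP[z zXY ->]; move: zXY; rewrite !inE.
    by case/andP=> h zX; rewrite zX in h.
  move/subset_leq_card; rewrite cardsC1 card_ord cardX => hf ->.
  apply: leq_ltn_trans hf _; apply: leq_trans (leq_sub2l _ cardY).
  by rewrite addnK prednK // (leq_ltn_trans _ (fa x0)).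
move: x1X y1X; rewrite !inE => /andP[hx1 x1X] /andP[_ y1X].
rewrite x1X /= in hx1.
have [u0 [v0 [c0 [hu0 hv0]]]] :=
  block_consecutive x0X y0X xy0 (congr1 val fxy0).
have [u1 [v1 [c1 [hu1 hv1]]]] :=
  block_consecutive x1X y1X xy1 (congr1 val fxy1).
have ne : (x1 %/ b == x0 %/ b) = false by apply/negbTE.
have arc (u v w : 'I_N) (uX : u \in X) (wX : w \in X) :
    consecutive_in X u v -> u %/ b = v %/ b -> (u %/ b == w %/ b) = false ->
    dependency (induced X (@block_coloring N b)) (exist _ w wX) (exist _ u uX).
  move=> cuv uv uw; apply/dependency_inducedP; exists u, v; split=> //=.
  - rewrite !inE; apply/norP.
    by split; apply/eqP=> e; move: uw; rewrite e ?uv eqxx.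
  - by rewrite block_coloringE uv eqxx.
  - by rewrite !block_coloringE -uv.
  by rewrite set21.
have u0X : u0 \in X by case/and4P: c0.
have u1X : u1 \in X by case/and4P: c1.
(* Each vertex is blue to both ends of the red pair in the other block, which gives opposite
   arcs. *)
exists [:: exist _ u0 u0X; exist _ u1 u1X]; split=> //.
apply/andP; split.
  rewrite /= andbT; apply/andP; split.
    by apply: (arc _ v1); rewrite // hu1 ?hv1 ?hu0.
  by apply: (arc _ v0); rewrite // hu0 ?hv0 ?hu1 // eq_sym.
rewrite /= inE andbT -val_eqE /=; apply/eqP=> e.
by move: ne; rewrite -hu0 -hu1 e eqxx.
Qed.

Theorem theorem1p3 (k : nat) (hk : 3 <= k) : is_f k (k ^ 2 %/ 4 + 1).
Proof.
split=> [|N]; first by apply: forces_of_large; lia.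
(* The remainder of [k ^ 2] modulo 4 is the parity of [k]. *)
have -> : k ^ 2 %/ 4 = uphalf k * k./2.
  have -> : k ^ 2 = (uphalf k * k./2) * 4 + odd k.
    by rewrite uphalf_half -{1}(odd_double_half k); case: odd; nia.
  by rewrite divnMDl // divn_small ?addn0 //; case: odd.
rewrite addn1 ltnNge => fN; apply/negP => Nle; move: fN.
have {1}-> : k = uphalf k + k./2 by rewrite uphalf_half; lia.
by apply: not_forces_blocks => //; lia.
Qed.
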